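(* Let $P$ be the Gaussian parity and let $n\in\mathbb{N}$ (positive). Let $\mathscr{S}_n=\{\theta_n[m|m]: m\in\mathbb{N}\}$, where $\theta_n[m|m]$ is regarded as an invariant of virtual knots (or long virtual knots) via $D\mapsto\theta_n[m|m](\Lambda[m](D))$. Then $\mathscr{S}_n$ is a rationally linearly independent set of Kauffman finite-type invariants of degree exactly $n$. Hence the set of Kauffman finite-type invariants of degree exactly $n$ is infinite dimensional for every $n$.
   Context: A Gauss diagram is a fixed base (the oriented line $\mathbb{R}$ for long virtual knots, or the oriented circle $S^1$ for virtual knots) with finitely many arrows, each with a sign $\oplus$ or $\ominus$, all endpoints distinct, up to orientation-preserving homeomorphism. $C(D)$ is the set of arrows. (Long) virtual knots are equivalence classes of Gauss diagrams under the usual Reidemeister moves for Gauss diagrams. Two arrows are linked if their endpoints alternate. Gaussian parity: an arrow is odd (even) if it is linked with an odd (even) number of arrows. $f(D)$ deletes all odd arrows of $D$. For $m\in\mathbb{N}$, the $f^m$-label of $x\in C(D)$ is the least $i$, $1\le i\le m$, with $x\notin C(f^i(D))$, and $m+1$ if there is none. $\Lambda[m](D)$ is $D$ with its $f^m$-labelling. For a signed arrow diagram $D$ with arrows labelled by elements of $\{1,\dots,m+1\}$ and $1\le k\le m$, $\theta[m|k](D)$ is the number of arrows of $D$ signed $\oplus$ and labelled $k$ minus the number of arrows of $D$ signed $\ominus$ and labelled $k$; $\theta_t[m|k](D)=(\theta[m|k](D))^t$. Kauffman finite type. A crossing change at an arrow reverses its sign and direction. An invariant $w$ is of Kauffman finite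 type of degree $\le n$ if it vanishes on diagrams with more than $n$ graphical vertices, a graphical vertex being (positive crossing) $-$ (negative crossing): for every $D$ and every set $S$ of more than $n$ arrows, $\sum_{T\subseteq S}(-1)^{|T|}w(D_T)=0$, $D_T$ being $D$ with crossing changes at the arrows in $T$. It has degree exactly $n$ if it is of degree $\le n$ but not $\le n-1$. *)

(* Defs.v *)
From mathcomp Require Import all_boot all_order all_algebra.
From Stdlib Require Import Relation_Operators.

Set Implicit Arguments.
Unset Strict Implicit.
Unset Printing Implicit Defensive.

Import Order.TTheory GRing.Theory Num.Theory.

(* A Gauss diagram is encoded by its signed Gauss code: the sequence of the
   endpoints of its arrows in the order in which they are met along the
   oriented base (for the circle, starting from an arbitrary cut point).  An
   endpoint records the name of its arrow, whether it is the tail ([true]) or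
   the head ([false]) of that arrow, and whether that arrow is signed (+)
   ([true]) or (-) ([false]).  Arrow names carry no meaning: diagrams that
   differ by a renaming (or, on the circle, by the choice of the cut point) are
   identified by [iso] below. *)
Definition endpoint : Type := (nat * bool * bool)%type.

Definition name (e : endpoint) : nat := e.1.1.

Definition tail_of (s : bool) (x : nat) : endpoint := (x, true, s).
Definition head_of (s : bool) (x : nat) : endpoint := (x, false, s).

Definition opposite (e : endpoint) : endpoint := (e.1.1, ~~ e.1.2, e.2).

Definition gauss_code (w : seq endpoint) : bool :=
  uniq [seq e.1 | e <- w] && all (fun e => opposite e \in w) w.

Record diagram : Type :=
  Diagram { code : seq endpoint; codeP : gauss_code code }.

Definition arrows (D : diagram) : seq nat := undup [seq name e | e <- code D].

(* C(D) *)
Definition arrow (D : diagram) : finType := seq_sub (arrows D).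

Definition positive (D : diagram) (x : nat) : bool := tail_of true x \in code D.
Definition negative (D : diagram) (x : nat) : bool := tail_of false x \in code D.

Definition linked (D : diagram) (x y : nat) : bool :=
  [seq name e | e <- code D & name e \in [:: x; y]]
    \in [:: [:: x; y; x; y]; [:: y; x; y; x]].

Definition odd_arrow (D : diagram) (x : nat) : bool :=
  odd (count (linked D x) (arrows D)).

Lemma delete_codeP (D : diagram) (p : pred nat) :
  gauss_code [seq e <- code D | ~~ p (name e)].
Proof.
case: D => w /= /andP [Uw /allP Ow]; apply/andP; split.
  by apply: subseq_uniq Uw; apply/map_subseq/filter_subseq.
apply/allP => e; rewrite mem_filter => /andP [pe /Ow ew].
by rewrite mem_filter ew andbT.
Qed.

Definition delete (D : diagram) (p : pred nat) : diagram :=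
  Diagram (delete_codeP D p).

(* The map f of the Gaussian parity. *)
Definition parity_map (D : diagram) : diagram := delete D (odd_arrow D).

(* [find] returns [m] when no index of [iota 1 m] satisfies the predicate. *)
Definition flabel (m : nat) (D : diagram) (x : nat) : nat :=
  (find (fun i => x \notin arrows (iter i parity_map D)) (iota 1 m)).+1.

Record labelled_diagram (m : nat) : Type := Labelled {
  ldiagram : diagram;
  label : nat -> nat;
  labelP : forall x, x \in arrows ldiagram -> 0 < label x <= m.+1 }.

Lemma flabelP (m : nat) (D : diagram) (x : nat) :
  x \in arrows D -> 0 < flabel m D x <= m.+1.
Proof. by move=> _; rewrite /flabel /= ltnS -{2}(size_iota 1 m) find_size. Qed.

Definition Lambda (m : nat) (D : diagram) : labelled_diagram m :=
  Labelled (flabelP m (D := D)).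

(* theta[m|k] *)
Definition theta (m k : nat) (L : labelled_diagram m) : int :=
  let D := ldiagram L in
  ((count (fun x => positive D x && (label L x == k)) (arrows D))%:Z
   - (count (fun x => negative D x && (label L x == k)) (arrows D))%:Z)%R.

(* theta_t[m|k] *)
Definition theta_pow (t m k : nat) (L : labelled_diagram m) : int :=
  (theta k L ^+ t)%R.

(* theta_n[m|m] o Lambda[m], with rational values. *)
Definition theta_inv (n m : nat) (D : diagram) : rat :=
  ((theta_pow n m (Lambda m D))%:~R)%R.

(* The line gives long virtual knots, the circle gives virtual knots. *)
Inductive base : Type := Line | Circle.

Definition rename (g : nat -> nat) (e : endpoint) : endpoint :=
  (g e.1.1, e.1.2, e.2).

Definition iso (b : base) (D D' : diagram) : Prop :=
  exists2 g : nat -> nat, injective g &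
    match b with
    | Line => code D' = map (rename g) (code D)
    | Circle => exists k, code D' = rot k (map (rename g) (code D))
    end.

Definition seg (o : bool) (e e' : endpoint) : seq endpoint :=
  if o then [:: e; e'] else [:: e'; e].

(* Arrows go from the overcrossing to the undercrossing, and signs are local
   writhes.  On the circle, a move across the cut point is a rotation followed
   by one of the moves below.

   In the third move the strands are T (top), M (middle) and B (bottom), with
   crossings x (T over M), y (T over B) and z (M over B).  Say that a strand
   bounding the triangle is coherent if it follows the boundary in the
   direction T, M, B; the edges of T, M and B then run from y to x, from x to z
   and from z to y.  [oT], [oM] and [oB] tell which strands are coherent, and
   [sg] whether the direction T, M, B is counterclockwise.  The sign of the
   crossing of an overstrand with direction p and an understrand with
   direction q being that of det(p, q), the signs are the products
     x : sg * oT * oM,    y : - sg * oT * oB,    z : sg * oM * oB,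
   and a product of three signs is the exclusive or of the three booleans.
   The move reverses the order of the two endpoints on each strand, keeping
   [sg] and reversing [oT], [oM] and [oB]. *)
Inductive reidemeister (D D' : diagram) : Prop :=
| Reidemeister1 (u v : seq endpoint) (x : nat) (s o : bool) of
    code D = u ++ v &
    code D' = u ++ seg o (tail_of s x) (head_of s x) ++ v
| Reidemeister2 (u v w : seq endpoint) (x y : nat) (s o : bool)
    (s1 s2 : seq endpoint) of
    perm_eq [:: s1; s2] [:: [:: tail_of s x; tail_of (~~ s) y];
                            seg o (head_of s x) (head_of (~~ s) y)] &
    code D = u ++ v ++ w &
    code D' = u ++ s1 ++ v ++ s2 ++ w
| Reidemeister3 (u0 u1 u2 u3 : seq endpoint) (x y z : nat)
    (sg oT oM oB : bool) (s1 s2 s3 : seq endpoint) of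
    (let sx := sg (+) oT (+) oM in
     let sy := ~~ (sg (+) oT (+) oB) in
     let sz := sg (+) oM (+) oB in
     perm_eq [:: s1; s2; s3] [:: seg oT (tail_of sy y) (tail_of sx x);
                                 seg oM (head_of sx x) (tail_of sz z);
                                 seg oB (head_of sz z) (head_of sy y)]) &
    code D = u0 ++ s1 ++ u1 ++ s2 ++ u2 ++ s3 ++ u3 &
    code D' = u0 ++ rev s1 ++ u1 ++ rev s2 ++ u2 ++ rev s3 ++ u3.

Definition same_knot (b : base) : diagram -> diagram -> Prop :=
  clos_refl_sym_trans diagram
    (fun D D' => iso b D D' \/ reidemeister D D').

Definition knot_invariant (b : base) (v : diagram -> rat) : Prop :=
  forall D D', same_knot b D D' -> v D = v D'.

Definition flip (p : pred nat) (e : endpoint) : endpoint :=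
  if p (name e) then (e.1.1, ~~ e.1.2, ~~ e.2) else e.

Lemma flip_codeP (D : diagram) (p : pred nat) :
  gauss_code (map (flip p) (code D)).
Proof.
case: D => w /= /andP [Uw /allP Ow].
have fK : involutive (fun e : nat * bool => (e.1, p e.1 (+) e.2)).
  by case=> x r /=; rewrite addbA addbb.
apply/andP; split.
  rewrite -map_comp (eq_map (g := (fun e => (e.1, p e.1 (+) e.2)) \o fst)).
    by rewrite map_comp map_inj_uniq //; apply: inv_inj.
  by case=> [[x r] s]; rewrite /flip /name /=; case: (p x).
apply/allP => _ /mapP [e /Ow ew ->]; apply/mapP; exists (opposite e) => //.
by case: e {ew} => [[x r] s]; rewrite /opposite /flip /name /=; case: (p x).
Qed.

(* D_T *)
Definition crossing_changes (D : diagram) (T : {set arrow D}) : diagram :=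
  Diagram (flip_codeP D (fun x => x \in [seq val a | a in T])).

Definition vanishes_above (n : nat) (v : diagram -> rat) : Prop :=
  forall (D : diagram) (S : {set arrow D}), n < #|S| ->
    (\sum_(T : {set arrow D} | T \subset S)
       (-1) ^+ #|T| * v (crossing_changes T) = 0)%R.

Definition kauffman_degree_le (b : base) (n : nat) (v : diagram -> rat) : Prop :=
  knot_invariant b v /\ vanishes_above n v.

(* Used for n > 0. *)
Definition kauffman_degree_exactly (b : base) (n : nat) (v : diagram -> rat) :
    Prop :=
  kauffman_degree_le b n v /\ ~ kauffman_degree_le b n.-1 v.

Definition rat_independent (X : Type) (A : (X -> rat) -> Prop) : Prop :=
  forall (N : nat) (F : 'I_N -> X -> rat), injective F -> (forall i, A (F i)) ->
  forall c : 'I_N -> rat, (forall x, \sum_(i < N) c i * F i x = 0)%R ->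
  forall i, c i = 0%R.

Definition finite_dimensional (X : Type) (A : (X -> rat) -> Prop) : Prop :=
  exists (N : nat) (F : 'I_N -> X -> rat), forall v, A v ->
  exists c : 'I_N -> rat, forall x, (v x = \sum_(i < N) c i * F i x)%R.

Definition theta_set (n : nat) (v : diagram -> rat) : Prop :=
  exists2 m, 0 < m & v = theta_inv n m.

(* Main.v *)
Require Import Defs.
From mathcomp Require Import all_boot all_order all_algebra.
From mathcomp Require Import zify ring lra.

Set Implicit Arguments.
Unset Strict Implicit.
Unset Printing Implicit Defensive.

Import GRing.Theory Num.Theory.

(** The heart of the matter is a second description of the Gaussian parity: an
    arrow is odd exactly when an odd number of endpoints lies between its two
    endpoints, because each linked arrow has one endpoint there and each other
    arrow has none or two ([odd_arrowE]).  Equivalently, the positions of its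
    two endpoints along the base have the same parity.  With positions at hand,
    the behaviour of the parity under the moves is read off:
    - a loop has adjacent endpoints and is even;
    - the two arrows of a bigon have the same parity, and inserting them shifts
      all the other endpoints by an even amount;
    - in a triangle, the move shifts both endpoints of each arrow by one, so
      parities are kept, and since the six positions form three adjacent pairs, the number
      of odd arrows of the triangle is even.
    It follows that deleting the odd arrows turns equivalent diagrams into
    equivalent diagrams ([parity_map_move]), and that the sum of the signs of
    the odd arrows, the odd writhe, is an invariant ([odd_writhe_move]).

    Now [theta m.+1 (Lambda m.+1 D)] is the odd writhe of the diagram obtained
    after [m] deletions ([theta_odd_writhe]): the arrows with the last label but
    one are those that are present and odd at that stage.  So it is an
    invariant.  Crossing changes alter neither parities nor labels, they only
    reverse the signs of the arrows concerned; hence the power [n] of theta is a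
    polynomial of degree [n] in the signs, its alternating sums over more than
    [n] arrows vanish, and over [n] arrows they are, up to sign, [2 ^ n * n!]
    times the product of the weights of these arrows
    ([alternating_sum_power]).

    For the examples, [parity_map] is onto ([parity_map_onto]): hanging a small
    new arrow on each odd arrow makes the old arrows even and the new ones odd.
    Lifting [m] times a bundle of [2 * n] mutually linked positive arrows gives
    a diagram with at least [n] arrows of label [m.+1], with nonzero theta at
    level [m.+1] and with zero theta at all higher levels
    ([exists_deep_bundle]).  This shows that the degree is exactly [n], and, by
    triangularity, that the invariants are distinct and linearly
    independent. *)

(** * Parity of positions and the Gaussian parity *)

Definition names (D : diagram) : seq nat := [seq name e | e <- code D].

Lemma mem_arrows D x : (x \in arrows D) = (x \in names D).
Proof. exact: mem_undup. Qed.

Lemma diagram_inj D D' : code D = code D' -> D = D'.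
Proof.
case: D => w p; case: D' => w' p' /= E; rewrite -E in p' *.
by rewrite (bool_irrelevance p p').
Qed.

(** The parity of the sum of the positions, counted from 0, of the letters of
    [s] that satisfy [P]: an initial letter has position 0 and shifts all
    the later ones by one. *)
Fixpoint position_parity (P : pred nat) (s : seq nat) : bool :=
  if s is _ :: s' then position_parity P s' (+) odd (count P s') else false.

Lemma position_parity_cat P s t :
  position_parity P (s ++ t) =
  position_parity P s (+) position_parity P t (+)
    (odd (size s) && odd (count P t)).
Proof.
elim: s => [|y s IHs] /=; first by rewrite addbF.
rewrite IHs count_cat oddD.
by case: (position_parity P s); case: (position_parity P t);
  case: (odd (size s)); case: (odd (count P s)); case: (odd (count P t)).
Qed.

Lemma position_parity0 P s : ~~ has P s -> position_parity P s = false.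
Proof.
elim: s => //= y s IHs; rewrite negb_or => /andP [_ Ps].
by rewrite IHs //; move: Ps; rewrite has_count -eqn0Ngt => /eqP ->.
Qed.

Lemma position_parity_pair P s :
  size s = 2 -> all P s -> position_parity P s.
Proof. by case: s => [|a [|b []]] //= _ /and3P [_ ->]. Qed.

Lemma position_parity_rev_pair P u s v : size s = 2 ->
  position_parity P (u ++ rev s ++ v) =
  position_parity P (u ++ s ++ v) (+) odd (count P s).
Proof.
case: s => [|a [|b []]] //= _; rewrite !position_parity_cat /= !oddD !oddb.
by case: (P a); case: (P b); case: (position_parity P u);
  case: (position_parity P v); case: (odd (count P v)); case: (odd (size u)).
Qed.

Lemma eq_position_parity P Q s :
  P =1 Q -> position_parity P s = position_parity Q s.
Proof. by move=> E; elim: s => //= y s ->; rewrite (eq_count E). Qed.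

Lemma position_parityU P Q s : (forall z, ~~ (P z && Q z)) ->
  position_parity (predU P Q) s = position_parity P s (+) position_parity Q s.
Proof.
move=> PQ; elim: s => //= y s ->.
rewrite (_ : count _ s = count P s + count Q s).
  by rewrite oddD -!addbA; congr (_ (+) _); rewrite addbCA.
rewrite -count_predUI (_ : count (predI P Q) s = 0) ?addn0 //.
by rewrite (@eq_count _ _ pred0) ?count_pred0 // => z; apply/negbTE/PQ.
Qed.

Lemma odd_count (T : Type) (P : pred T) (s : seq T) :
  odd (count P s) = \big[addb/false]_(x <- s) P x.
Proof.
by elim: s => [|x s IHs]; rewrite ?big_nil // big_cons /= oddD IHs oddb.
Qed.

Lemma odd_size_counts (r v : seq nat) : uniq r -> {subset v <= r} ->
  odd (size v) = \big[addb/false]_(y <- r) odd (count_mem y v).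
Proof.
move=> Ur; elim: v => [|z v IHv] vr /=.
  by rewrite big1.
rewrite IHv; last by move=> y yv; apply: vr; rewrite inE yv orbT.
under [in RHS]eq_bigr => y _ do rewrite oddD oddb.
rewrite big_split /= -[LHS]addTb; congr (_ (+) _); apply/esym.
rewrite (eq_bigr (pred1 z)) => [|y _]; last by rewrite /= eq_sym.
by rewrite -odd_count count_uniq_mem ?vr ?mem_head.
Qed.

Lemma uniq_endpoints D : uniq [seq e.1 | e <- code D].
Proof. by case/andP: (codeP D). Qed.

Lemma opposite_mem D e : e \in code D -> opposite e \in code D.
Proof. by case/andP: (codeP D) => _ /allP; apply. Qed.

Lemma count_names D x : x \in names D -> count_mem x (names D) = 2.
Proof.
move=> /mapP [e eD ->{x}].
have mem_end r : (name e, r) \in [seq e'.1 | e' <- code D].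
  have [<-|] := eqVneq e.1.2 r.
    by apply/mapP; exists e => //; case: e {eD} => [[? ?] ?].
  move=> er; apply/mapP; exists (opposite e); first exact: opposite_mem.
  by move: er; case: e {eD} => [[? []] ?]; case: r.
rewrite /names (_ : map name _ = map fst [seq e'.1 | e' <- code D]); last first.
  by rewrite -map_comp.
have U := uniq_endpoints D.
rewrite count_map (eq_count (a2 := predU (pred1 (name e, true))
                                        (pred1 (name e, false)))); last first.
  by case=> y []; rewrite /= !xpair_eqE ?andbT ?andbF ?orbF.
rewrite -[LHS]addn0.
rewrite -[X in _ + X](count_pred0 [seq e'.1 | e' <- code D]).
rewrite (eq_count (a1 := pred0) (a2 := predI (pred1 (name e, true))
                                        (pred1 (name e, false)))); last first.
  by case=> y []; rewrite /= !xpair_eqE ?andbT ?andbF.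
by rewrite count_predUI !count_uniq_mem // !mem_end.
Qed.

Lemma odd_count_names D x : odd (count_mem x (names D)) = false.
Proof.
have [/count_names ->|] // := boolP (x \in names D).
by move=> /count_memPn ->.
Qed.

Lemma filter_mem2_nseq (x y : nat) (s : seq nat) : x \notin s ->
  [seq z <- s | z \in [:: x; y]] = nseq (count_mem y s) y.
Proof.
elim: s => //= z s IHs; rewrite !inE negb_or eq_sym => /andP [/negbTE zx xs].
by rewrite zx IHs //; case: eqP => [->|].
Qed.

(** Since [y] has two endpoints, an odd number of them in [v] means exactly one
    there and one outside, which is alternation. *)
Lemma linkedE D x y u v w : x != y -> y \in names D ->
  names D = u ++ x :: v ++ x :: w -> x \notin u ++ v ++ w ->
  linked D x y = odd (count_mem y v).
Proof.
move=> xy yD Ew; rewrite !mem_cat !negb_or => /and3P [xu xv xw].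
have := count_names yD.
rewrite /linked -[map _ _](filter_map name (mem [:: x; y])) -/(names D) Ew.
rewrite !(filter_cat, count_cat) /= !(filter_cat, count_cat) /= !inE eqxx /=.
rewrite !filter_mem2_nseq // (negbTE xy) !add0n.
(* y occurs twice, so its occurrences split as 2 = a + d + c over u, v, w. *)
case: (count_mem y u) (count_mem y v) (count_mem y w)
  => [|[|[|a]]] [|[|[|d]]] [|[|[|c]]] //= _;
  by rewrite ?inE ?eqseq_cons ?eqxx ?(negbTE xy) ?[y == x]eq_sym ?(negbTE xy)
    ?andbF.
Qed.

Lemma split_first (x : nat) s : x \in s ->
  exists u v, s = u ++ x :: v /\ x \notin u.
Proof.
elim: s => // y s IHs; have [<- _|yx] := eqVneq y x; first by exists [::], s.
rewrite inE eq_sym (negbTE yx) => /IHs [u [v [-> xu]]].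
by exists (y :: u), v; rewrite inE negb_or eq_sym yx.
Qed.

Lemma split_twice (x : nat) s : count_mem x s = 2 ->
  exists u v w, s = u ++ x :: v ++ x :: w /\ x \notin u ++ v ++ w.
Proof.
move=> c2; have /split_first [u [t [E xu]]] : x \in s.
  by rewrite -has_pred1 has_count c2.
move: c2; rewrite E count_cat /= eqxx (count_memPn xu) add0n add1n => -[ct].
have /split_first [v [w [Et xv]]] : x \in t by rewrite -has_pred1 has_count ct.
exists u, v, w; rewrite Et; split=> //.
move: ct; rewrite Et count_cat /= eqxx (count_memPn xv) add0n add1n.
move=> -[/count_memPn xw].
by rewrite !mem_cat !negb_or xu xv.
Qed.

(** Between the two endpoints of [x] each linked arrow contributes one letter
    and every other arrow none or two, so [x] is odd when an odd number of
    letters separates its endpoints, that is, when these are at positions of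
    the same parity. *)
Theorem odd_arrowE D x : x \in names D ->
  odd_arrow D x = ~~ position_parity (pred1 x) (names D).
Proof.
move=> xD; have [u [v [w [E xuvw]]]] := split_twice (count_names xD).
have vD : {subset v <= arrows D}.
  by move=> y yv; rewrite mem_arrows E !(mem_cat, inE) yv !orbT.
rewrite /odd_arrow odd_count.
transitivity (odd (size v)).
  rewrite (odd_size_counts (undup_uniq _) vD); apply: eq_big_seq => y.
  rewrite mem_arrows => yD; have [->|xy] := eqVneq y x; last first.
    by apply: (linkedE _ yD E xuvw); rewrite eq_sym.
  move: xuvw; rewrite !mem_cat !negb_or => /and3P [xu xv xw].
  rewrite /linked -[map _ _](filter_map name (mem [:: x; x])) -/(names D) E.
  rewrite !(filter_cat, count_cat) /= !(filter_cat, count_cat) /= !inE eqxx /=.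
  by rewrite !filter_mem2_nseq // !(count_memPn _) //= !eqseq_cons !andbF.
rewrite E; move: xuvw; rewrite !mem_cat !negb_or => /and3P [xu xv xw].
rewrite position_parity_cat /= position_parity_cat /= !count_cat /= eqxx.
rewrite !position_parity0 ?has_pred1 // !(count_memPn _) //=.
by rewrite !andbF andbT addbF addbT negbK.
Qed.

(** * The odd writhe *)

Lemma odd_arrow_eq D D' x x' : x \in names D -> x' \in names D' ->
    position_parity (pred1 x) (names D) =
      position_parity (pred1 x') (names D') ->
  odd_arrow D x = odd_arrow D' x'.
Proof. by move=> xD xD' E; rewrite !odd_arrowE // E. Qed.

Lemma even_size_names D : odd (size (names D)) = false.
Proof.
rewrite (odd_size_counts (undup_uniq (names D))); last first.
  by move=> y; rewrite mem_undup.
by apply: big1 => y _; apply: odd_count_names.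
Qed.

Lemma endpoint_inj D e e' :
  e \in code D -> e' \in code D -> e.1 = e'.1 -> e = e'.
Proof.
have := uniq_endpoints D; elim: (code D) => //= d w IHw /andP [dw /IHw {}IHw].
rewrite !inE => /predU1P [->|ew] /predU1P [->|ew'] //; last exact: IHw.
- by move=> E; case/negP: dw; rewrite E map_f.
- by move=> E; case/negP: dw; rewrite -E map_f.
Qed.

Lemma notin_rest D x s t :
  perm_eq (names D) (s ++ t) -> count_mem x s = 2 -> x \notin t.
Proof.
move=> pD c2; apply/count_memPn.
have /count_names : x \in names D.
  by rewrite (perm_mem pD) mem_cat -has_pred1 has_count c2.
by rewrite (permP pD) count_cat c2 -[in RHS](addn0 2) => /addnI.
Qed.

Definition arrow_sign (D : diagram) (x : nat) : int :=
  ((positive D x)%:Z - (negative D x)%:Z)%R.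

Definition odd_sign (D : diagram) (x : nat) : int :=
  (if odd_arrow D x then arrow_sign D x else 0)%R.

Definition odd_writhe (D : diagram) : int :=
  (\sum_(x <- arrows D) odd_sign D x)%R.

Lemma arrow_signE D s x : tail_of s x \in code D ->
  arrow_sign D x = (if s then 1 else -1)%R.
Proof.
move=> xD; rewrite /arrow_sign /positive /negative.
have other : tail_of (~~ s) x \in code D = false.
  apply/negbTE/negP => xD'.
  by have /(congr1 snd) := endpoint_inj xD xD' erefl; case: (s).
by case: s xD other => /= -> ->; rewrite ?subr0 ?sub0r.
Qed.

Lemma arrow_sign_eq D D' x x' :
    (forall s, (tail_of s x \in code D) = (tail_of s x' \in code D')) ->
  arrow_sign D x = arrow_sign D' x'.
Proof. by move=> E; rewrite /arrow_sign /positive /negative !E. Qed.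

Lemma odd_sign_eq D D' x x' :
    odd_arrow D x = odd_arrow D' x' ->
    (forall s, (tail_of s x \in code D) = (tail_of s x' \in code D')) ->
  odd_sign D x = odd_sign D' x'.
Proof. by move=> E /arrow_sign_eq E'; rewrite /odd_sign E E'. Qed.

Local Notation even_part D w := [seq e <- w | ~~ odd_arrow D (name e)].

(** * The first move *)

Section Reidemeister1.

Variables (D D' : diagram) (u v : seq endpoint) (x : nat) (s o : bool).
Hypothesis codeD : code D = u ++ v.
Hypothesis codeD' : code D' = u ++ seg o (tail_of s x) (head_of s x) ++ v.

Let loop_names : map name (seg o (tail_of s x) (head_of s x)) = [:: x; x].
Proof. by case: o. Qed.

Let namesD' : names D' = map name u ++ [:: x; x] ++ map name v.
Proof. by rewrite /names codeD' !map_cat loop_names. Qed.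

Let namesD : names D = map name u ++ map name v.
Proof. by rewrite /names codeD map_cat. Qed.

Let x_fresh : x \notin names D.
Proof.
apply: (@notin_rest D' x [:: x; x]); last by rewrite /= eqxx.
by rewrite namesD namesD' perm_catCA.
Qed.

Lemma loop_even : odd_arrow D' x = false.
Proof.
move: x_fresh; rewrite namesD mem_cat negb_or => /andP [xu xv].
rewrite odd_arrowE ?namesD' ?mem_cat ?inE ?eqxx ?orbT //.
rewrite !position_parity_cat !count_cat /= eqxx.
rewrite !position_parity0 ?has_pred1 // (count_memPn xv) /=.
by rewrite !andbF.
Qed.

Lemma odd_arrow_loop z : z \in names D -> odd_arrow D' z = odd_arrow D z.
Proof.
move=> zD; have xz : x != z by apply: contraNneq x_fresh => ->.
apply: odd_arrow_eq => //.
  by move: zD; rewrite namesD namesD' !mem_cat => /orP [] ->; rewrite ?orbT.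
rewrite namesD namesD' !position_parity_cat !count_cat /= (negbTE xz) /=.
by rewrite addbF.
Qed.

Let filter_code w : {subset w <= code D} ->
  even_part D' w = even_part D w.
Proof.
by move=> wD; apply: eq_in_filter => e /wD eD; rewrite odd_arrow_loop ?map_f.
Qed.

Lemma parity_map_loop : reidemeister (parity_map D) (parity_map D').
Proof.
apply: (@Reidemeister1 _ _ (even_part D u) (even_part D v) x s o).
  by rewrite /= codeD filter_cat.
have [uD vD] : {subset u <= code D} /\ {subset v <= code D}.
  by split=> e ew; rewrite codeD mem_cat ew ?orbT.
rewrite /= codeD' !filter_cat (filter_code uD) (filter_code vD).
congr (_ ++ (_ ++ _)); apply/all_filterP.
by case: o; rewrite /= /name /= loop_even.
Qed.

Lemma odd_writhe_loop : odd_writhe D' = odd_writhe D.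
Proof.
have pD' : perm_eq (arrows D') (x :: arrows D).
  apply: uniq_perm; rewrite /= ?undup_uniq ?mem_arrows ?x_fresh // => z.
  rewrite inE !mem_arrows namesD namesD' !mem_cat !inE orbb.
  by rewrite orbCA.
rewrite /odd_writhe (perm_big _ pD') /= big_cons.
rewrite [odd_sign D' x]/odd_sign loop_even add0r.
apply: eq_big_seq => z; rewrite mem_arrows => zD.
apply: odd_sign_eq => [|r]; first exact: odd_arrow_loop.
have zx : z != x by apply: contraNneq x_fresh => <-.
rewrite codeD codeD' !mem_cat; congr (_ || _).
by case: o; rewrite !inE /tail_of /head_of !xpair_eqE (negbTE zx).
Qed.

End Reidemeister1.

(** * The second move *)

Section Reidemeister2.

Variables (D D' : diagram) (u v w : seq endpoint) (x y : nat) (s o : bool).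
Variables (s1 s2 : seq endpoint).
Hypothesis tails_heads :
  perm_eq [:: s1; s2] [:: [:: tail_of s x; tail_of (~~ s) y];
                          seg o (head_of s x) (head_of (~~ s) y)].
Hypothesis codeD : code D = u ++ v ++ w.
Hypothesis codeD' : code D' = u ++ s1 ++ v ++ s2 ++ w.

Let strand e := perm_eq (map name e) [:: x; y].

Let strands : strand s1 && strand s2.
Proof.
have := perm_all strand tails_heads; rewrite /= !andbT => ->.
rewrite /strand /=; case: o => /=; rewrite ?perm_refl //=.
by apply/permP => P /=; rewrite !addn0 addnC.
Qed.

Let s1P : strand s1. Proof. by case/andP: strands. Qed.
Let s2P : strand s2. Proof. by case/andP: strands. Qed.

Let codeD'_perm : perm_eq (code D')
  ([:: tail_of s x; tail_of (~~ s) y; head_of s x; head_of (~~ s) y] ++ code D).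
Proof.
have p12 : perm_eq (s1 ++ s2)
    [:: tail_of s x; tail_of (~~ s) y; head_of s x; head_of (~~ s) y].
  have := perm_flatten tails_heads; rewrite /= !cats0 => /perm_trans; apply.
  by case: o => //; apply/permP => P /=; lia.
move/permP: p12 => p12; apply/permP => P; have := p12 P.
by rewrite codeD' codeD !count_cat; lia.
Qed.

Let x_neq_y : x != y.
Proof.
apply: contraTneq (uniq_endpoints D') => E.
by rewrite (perm_uniq (perm_map fst codeD'_perm)) /= E mem_head.
Qed.

Let namesD'_perm : perm_eq (names D') ([:: x; y; x; y] ++ names D).
Proof. exact: (perm_map name codeD'_perm). Qed.

Let x_fresh : x \notin names D.
Proof.
by apply: notin_rest namesD'_perm _; rewrite /= eqxx eq_sym (negbTE x_neq_y).
Qed.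

Let y_fresh : y \notin names D.
Proof.
by apply: notin_rest namesD'_perm _; rewrite /= eqxx (negbTE x_neq_y).
Qed.

Let namesD' : names D' =
  map name u ++ map name s1 ++ map name v ++ map name s2 ++ map name w.
Proof. by rewrite /names codeD' !map_cat. Qed.

Let namesD : names D = map name u ++ map name v ++ map name w.
Proof. by rewrite /names codeD !map_cat. Qed.

Let strand_size e : strand e -> size (map name e) = 2.
Proof. exact: perm_size. Qed.

Lemma odd_arrow_bigon z : z \in names D -> odd_arrow D' z = odd_arrow D z.
Proof.
move=> zD.
have xz : x != z by apply: contraNneq x_fresh => ->.
have yz : y != z by apply: contraNneq y_fresh => ->.
have absent e : strand e -> ~~ has (pred1 z) (map name e).
  by move=> se; rewrite has_pred1 (perm_mem se) !inE ![z == _]eq_sym negb_or xz.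
apply: odd_arrow_eq => //.
  by rewrite (perm_mem namesD'_perm) mem_cat zD orbT.
have [a1 a2] := (absent _ s1P, absent _ s2P).
rewrite namesD namesD' !position_parity_cat !count_cat.
rewrite (position_parity0 a1) (position_parity0 a2).
rewrite (strand_size s1P) (strand_size s2P).
move: a1 a2; rewrite !has_count -!eqn0Ngt => /eqP -> /eqP ->.
by rewrite !addFb !add0n !addbF.
Qed.

(** Each of the two adjacent pairs of positions has odd sum, so the four
    endpoints of the bigon have an even sum of positions. *)
Lemma bigon_same_parity : odd_arrow D' x = odd_arrow D' y.
Proof.
have pXY z : z \in [:: x; y] -> z \in names D'.
  by rewrite (perm_mem namesD'_perm) mem_cat !inE => /orP [] ->; rewrite ?orbT.
apply: odd_arrow_eq; rewrite ?pXY ?inE ?eqxx ?orbT //.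
have disj z : ~~ (pred1 x z && pred1 y z).
  apply/negP => /= /andP [/eqP -> /eqP xy].
  by move: x_neq_y; rewrite xy eqxx.
have absent (t : seq nat) : x \notin t -> y \notin t ->
    ~~ has (predU (pred1 x) (pred1 y)) t.
  by move=> xt yt; rewrite has_predU !has_pred1 negb_or xt.
have inside e : strand e -> all (predU (pred1 x) (pred1 y)) (map name e).
  by move=> se; rewrite (perm_all _ se) /= !eqxx orbT.
move: x_fresh y_fresh; rewrite namesD !mem_cat !negb_or.
move=> /and3P [xu xv xw] /and3P [yu yv yw].
have := position_parityU (names D') disj.
rewrite {1}namesD' !position_parity_cat !count_cat.
rewrite (position_parity_pair (strand_size s1P) (inside _ s1P)).
rewrite (position_parity_pair (strand_size s2P) (inside _ s2P)).
rewrite !(position_parity0 (absent _ _ _)) //.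
have count0 (t : seq nat) : x \notin t -> y \notin t ->
    count (predU (pred1 x) (pred1 y)) t = 0.
  by move=> xt yt; apply/eqP; rewrite eqn0Ngt -has_count absent.
have count2 e : strand e -> count (predU (pred1 x) (pred1 y)) (map name e) = 2.
  move=> se; have := inside _ se; rewrite all_count => /eqP ->.
  exact: strand_size.
rewrite (count2 _ s1P) (count2 _ s2P) !count0 // !andbF /=.
by case: (position_parity _ _); case: (position_parity _ _).
Qed.

(** A bigon is either kept or deleted as a whole. *)
Lemma parity_map_bigon :
  reidemeister (parity_map D) (parity_map D') \/ parity_map D = parity_map D'.
Proof.
have filter_code t : {subset t <= code D} ->
    even_part D' t = even_part D t.
  by move=> tD; apply: eq_in_filter => e /tD eD; rewrite odd_arrow_bigon ?map_f.
have uD : {subset u <= code D} by move=> e et; rewrite codeD !mem_cat et.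
have vD : {subset v <= code D} by move=> e et; rewrite codeD !mem_cat et orbT.
have wD : {subset w <= code D} by move=> e et; rewrite codeD !mem_cat et !orbT.
have strand_parity t e : strand t -> e \in t ->
    odd_arrow D' (name e) = odd_arrow D' x.
  move=> st /(map_f name); rewrite (perm_mem st) !inE.
  by move=> /orP [] /eqP -> //; rewrite bigon_same_parity.
have filter_strand t : strand t ->
    even_part D' t = if odd_arrow D' x then [::] else t.
  move=> st; rewrite (eq_in_filter (a2 := fun=> ~~ odd_arrow D' x)).
    by case: (odd_arrow D' x); rewrite ?filter_pred0 ?filter_predT.
  by move=> e /(strand_parity _ _ st) ->.
have E : code (parity_map D') = even_part D u ++
    (if odd_arrow D' x then [::] else s1) ++ even_part D v ++
    (if odd_arrow D' x then [::] else s2) ++ even_part D w.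
  rewrite /= codeD' !filter_cat.
  rewrite (filter_code _ uD) (filter_code _ vD) (filter_code _ wD).
  by rewrite (filter_strand _ s1P) (filter_strand _ s2P).
case x_odd: (odd_arrow D' x) E => E.
  by right; apply: diagram_inj; rewrite E /= codeD !filter_cat.
left; apply: Reidemeister2 tails_heads _ E.
by rewrite /= codeD !filter_cat.
Qed.

(** The arrows of a bigon have opposite signs and the same parity. *)
Lemma odd_writhe_bigon : odd_writhe D' = odd_writhe D.
Proof.
have pD' : perm_eq (arrows D') (x :: y :: arrows D).
  apply: uniq_perm; rewrite /= ?undup_uniq //.
    by rewrite inE negb_or x_neq_y !mem_arrows x_fresh y_fresh.
  move=> z; rewrite mem_arrows (perm_mem namesD'_perm) !inE mem_arrows.
  by case: (z == x); case: (z == y).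
have endD' e : e \in [:: tail_of s x; tail_of (~~ s) y] -> e \in code D'.
  by rewrite (perm_mem codeD'_perm) mem_cat !inE => /orP [] ->; rewrite ?orbT.
have cancel : (odd_sign D' x + odd_sign D' y = 0)%R.
  rewrite /odd_sign -bigon_same_parity.
  rewrite (@arrow_signE D' s x) ?endD' ?mem_head //.
  rewrite (@arrow_signE D' (~~ s) y) ?endD' ?inE ?eqxx ?orbT //.
  by case: (odd_arrow D' x); case: (s).
rewrite /odd_writhe (perm_big _ pD') /= !big_cons addrA cancel add0r.
apply: eq_big_seq => z; rewrite mem_arrows => zD.
apply: odd_sign_eq => [|r]; first exact: odd_arrow_bigon.
have zx : z != x by apply: contraNneq x_fresh => <-.
have zy : z != y by apply: contraNneq y_fresh => <-.
rewrite (perm_mem codeD'_perm) mem_cat !inE /tail_of /head_of !xpair_eqE.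
by rewrite (negbTE zx) (negbTE zy).
Qed.

End Reidemeister2.

(** * The third move *)

Section Reidemeister3.

Variables (D D' : diagram) (u0 u1 u2 u3 : seq endpoint) (x y z : nat).
Variables (sx sy sz oT oM oB : bool) (s1 s2 s3 : seq endpoint).
Hypothesis strandsE :
  perm_eq [:: s1; s2; s3] [:: seg oT (tail_of sy y) (tail_of sx x);
                              seg oM (head_of sx x) (tail_of sz z);
                              seg oB (head_of sz z) (head_of sy y)].
Hypothesis codeD : code D = u0 ++ s1 ++ u1 ++ s2 ++ u2 ++ s3 ++ u3.
Hypothesis codeD' :
  code D' = u0 ++ rev s1 ++ u1 ++ rev s2 ++ u2 ++ rev s3 ++ u3.

Let from_strands (P : pred (seq endpoint)) :
    P (seg oT (tail_of sy y) (tail_of sx x)) ->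
    P (seg oM (head_of sx x) (tail_of sz z)) ->
    P (seg oB (head_of sz z) (head_of sy y)) ->
  [/\ P s1, P s2 & P s3].
Proof.
move=> PT PM PB; have := perm_all P strandsE.
by rewrite /= PT PM PB => /and4P [].
Qed.

Let strand_ends : perm_eq (s1 ++ s2 ++ s3)
  [:: tail_of sy y; tail_of sx x; head_of sx x; tail_of sz z; head_of sz z;
      head_of sy y].
Proof.
have := perm_flatten strandsE; rewrite /= !cats0 => /perm_trans; apply.
by case: oT; case: oM; case: oB => //; apply/permP => P /=; lia.
Qed.

Let outside := u0 ++ u1 ++ u2 ++ u3.

Let codeD_perm : perm_eq (code D) ((s1 ++ s2 ++ s3) ++ outside).
Proof. by apply/permP => P; rewrite codeD !count_cat; lia. Qed.

Let codeD'_perm : perm_eq (code D') (code D).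
Proof.
by apply/permP => P; rewrite codeD codeD' !count_cat !count_rev; lia.
Qed.

Let names_codeD_perm : perm_eq (names D)
  ([:: y; x; x; z; z; y] ++ map name outside).
Proof.
apply: perm_trans (perm_map name codeD_perm) _.
by rewrite map_cat perm_cat2r; apply: (perm_map name strand_ends).
Qed.

Let endpoints_uniq : uniq [:: (y, true); (x, true); (x, false);
                              (z, true); (z, false); (y, false)].
Proof.
have := uniq_endpoints D.
rewrite (perm_uniq (perm_map fst codeD_perm)) map_cat cat_uniq => /andP [U _].
by rewrite (perm_uniq (perm_map fst strand_ends)) in U.
Qed.

Let distinct : uniq [:: x; y; z].
Proof.
move: endpoints_uniq; rewrite /= !inE !xpair_eqE !eqxx !andbT !andbF !orbF.
rewrite !negb_or ![y == x]eq_sym.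
by case: (x == y); case: (y == z); case: (x == z).
Qed.

Let size_strands : [/\ size s1 = 2, size s2 = 2 & size s3 = 2].
Proof.
have [|||/eqP -> /eqP -> /eqP ->] // :=
    from_strands (P := fun s => size s == 2);
  by [case: oT | case: oM | case: oB].
Qed.

Let triangle : pred nat := mem [:: x; y; z].

Let triangle_strands : [/\ all triangle (map name s1),
  all triangle (map name s2) & all triangle (map name s3)].
Proof.
apply: (from_strands (P := fun s => all triangle (map name s)));
  rewrite /triangle; by [case: oT; rewrite /= !inE !eqxx ?orbT
     | case: oM; rewrite /= !inE !eqxx ?orbT
     | case: oB; rewrite /= !inE !eqxx ?orbT].
Qed.

Let count_ends t : ~~ odd (count_mem t (map name (s1 ++ s2 ++ s3))).
Proof.
rewrite (permP (perm_map name strand_ends)) /= !oddD !oddb.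
by case: (x == t); case: (y == t); case: (z == t).
Qed.

Let outside_triangle : ~~ has triangle (map name outside).
Proof.
apply/hasPn => t tU; apply/negP => tT; move: tU; apply/negP.
apply: notin_rest names_codeD_perm _; move: tT distinct.
rewrite /triangle !inE /= !inE negb_or andbT => tT /andP [/andP [xy xz] yz].
by case/or3P: tT => /eqP ->; rewrite !eqxx ?[y == x]eq_sym ?[z == x]eq_sym
  ?[z == y]eq_sym ?(negbTE xy) ?(negbTE xz) ?(negbTE yz).
Qed.

(** Each of the endpoints of the triangle is moved by one, and each arrow has
    none or both of its endpoints among them. *)
Lemma odd_arrow_triangle t : t \in names D -> odd_arrow D' t = odd_arrow D t.
Proof.
move=> tD; apply: odd_arrow_eq => //.
  by rewrite (perm_mem (perm_map name codeD'_perm)).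
have [z1 z2 z3] := size_strands.
have ctx := position_parity_rev_pair (pred1 t).
rewrite /names codeD codeD' !map_cat !map_rev ctx ?size_map //.
have := ctx (map name (u0 ++ s1 ++ u1)) (map name s2)
            (map name u2 ++ rev (map name s3) ++ map name u3).
rewrite !map_cat -!catA size_map => -> //.
have := ctx (map name (u0 ++ s1 ++ u1 ++ s2 ++ u2)) (map name s3) (map name u3).
rewrite !map_cat -!catA size_map => -> //.
rewrite -!addbA -[RHS]addbF; congr (_ (+) _); apply/negbTE.
have := count_ends t; rewrite !map_cat !count_cat !oddD.
by rewrite addbC -addbA addbCA addbC -!addbA.
Qed.

(** The six endpoints of the triangle fill three adjacent pairs of positions,
    so the sum of their positions is odd; an arrow being odd when its own sum is
    even, the three complements add up to an even number. *)
Lemma triangle_parity :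
  odd_arrow D x (+) odd_arrow D y (+) odd_arrow D z = false.
Proof.
have inD t : t \in [:: x; y; z] -> t \in names D.
  rewrite (perm_mem names_codeD_perm) mem_cat !inE.
  by move=> /or3P [] ->; rewrite ?orbT.
rewrite !odd_arrowE ?inD ?inE ?eqxx ?orbT // !addbN !addNb negbK.
apply/negbTE; rewrite negbK.
have [xy xz yz] : [/\ x != y, x != z & y != z].
  by move: distinct; rewrite /= !inE negb_or andbT => /andP [/andP [-> ->] ->].
transitivity (position_parity triangle (names D)).
  rewrite (@eq_position_parity triangle
    (predU (pred1 x) (predU (pred1 y) (pred1 z)))); last first.
    by move=> t; rewrite /triangle /= !inE.
  rewrite !position_parityU ?addbA // => t.
    by apply/negP => /andP [/eqP -> /eqP yz']; move: yz; rewrite yz' eqxx.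
  apply/negP => /andP [/eqP -> /orP [] /eqP E].
    by move: xy; rewrite E eqxx.
  by move: xz; rewrite E eqxx.
have [z1 z2 z3] := size_strands; have [t1 t2 t3] := triangle_strands.
move: outside_triangle; rewrite !map_cat !has_cat !negb_or.
move=> /and4P [o0 o1 o2 o3].
rewrite /names codeD !map_cat !position_parity_cat !count_cat !oddD.
rewrite (position_parity_pair _ t1) ?(position_parity_pair _ t2) ?size_map //.
rewrite (position_parity_pair _ t3) ?size_map //.
rewrite !position_parity0 // ?size_map z1 z2 z3.
have count0 (r : seq nat) : ~~ has triangle r -> count triangle r = 0.
  by rewrite has_count -eqn0Ngt => /eqP.
have count2 (r : seq nat) :
    size r = 2 -> all triangle r -> count triangle r = 2.
  by move=> <-; rewrite all_count => /eqP.
rewrite (count2 _ _ t1) ?(count2 _ _ t2) ?(count2 _ _ t3) ?size_map //.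
by rewrite !count0 //= !andbF.
Qed.

Lemma odd_writhe_triangle : odd_writhe D' = odd_writhe D.
Proof.
have mem_names : names D' =i names D by apply/perm_mem/perm_map/codeD'_perm.
have pD' : perm_eq (arrows D') (arrows D).
  apply: uniq_perm; rewrite ?undup_uniq // => t.
  by rewrite !mem_arrows mem_names.
rewrite /odd_writhe (perm_big _ pD') /=; apply: eq_big_seq => t.
rewrite mem_arrows => tD; apply: odd_sign_eq => [|r].
  exact: odd_arrow_triangle.
exact: (perm_mem codeD'_perm).
Qed.

Let survives (e : endpoint) := ~~ odd_arrow D (name e).

(** A triangle has none or two odd arrows.  In the second case each strand
    meets a deleted arrow, so at most one endpoint is left on it and reversing
    the strand has no effect any more. *)
Let surviving_strands :
  [/\ filter survives s1 = s1, filter survives s2 = s2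
      & filter survives s3 = s3] \/
  [/\ filter survives (rev s1) = filter survives s1,
      filter survives (rev s2) = filter survives s2 &
      filter survives (rev s3) = filter survives s3].
Proof.
have P := triangle_parity.
case xy_odd: (odd_arrow D x || odd_arrow D y || odd_arrow D z); [right|left].
  have [|||/eqP -> /eqP -> /eqP ->] // := from_strands
      (P := fun s => filter survives (rev s) == filter survives s);
    [case: oT | case: oM | case: oB]; move: P xy_odd;
    rewrite /= /survives /name /=;
    by case: (odd_arrow D x); case: (odd_arrow D y); case: (odd_arrow D z).
have [|||/eqP -> /eqP -> /eqP ->] // := from_strands
      (P := fun s => filter survives s == s);
    [case: oT | case: oM | case: oB]; move: xy_odd;
    rewrite /= /survives /name /=;
    by case: (odd_arrow D x); case: (odd_arrow D y); case: (odd_arrow D z).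
Qed.

Lemma parity_map_triangle :
  (exists w0 w1 w2 w3,
     code (parity_map D) = w0 ++ s1 ++ w1 ++ s2 ++ w2 ++ s3 ++ w3 /\
     code (parity_map D') =
       w0 ++ rev s1 ++ w1 ++ rev s2 ++ w2 ++ rev s3 ++ w3) \/
  parity_map D = parity_map D'.
Proof.
have cD : code (parity_map D) = filter survives (code D) by [].
have cD' : code (parity_map D') = filter survives (code D').
  apply: eq_in_filter => e; rewrite (perm_mem codeD'_perm) => eD.
  by rewrite /survives odd_arrow_triangle ?map_f.
case: surviving_strands => [[e1 e2 e3]|[e1 e2 e3]]; [left|right].
  exists (filter survives u0), (filter survives u1).
  exists (filter survives u2), (filter survives u3); split.
    by rewrite cD codeD !filter_cat e1 e2 e3.
  by rewrite cD' codeD' !filter_cat !filter_rev e1 e2 e3.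
by apply: diagram_inj; rewrite cD cD' codeD codeD' !filter_cat e1 e2 e3.
Qed.

End Reidemeister3.

(** * Invariance *)

(** In a word of even length a rotation moves each letter by [- k] up to an even
    amount, which does not change the parity of a sum of evenly many
    positions. *)
Lemma position_parity_rot P k s : ~~ odd (size s) -> ~~ odd (count P s) ->
  position_parity P (rot k s) = position_parity P s.
Proof.
rewrite -{1 2 4}(cat_take_drop k s) /rot size_cat count_cat !oddD.
rewrite !position_parity_cat.
by case: (odd (size (take k s))); case: (odd (size (drop k s)));
  case: (odd (count P (take k s))); case: (odd (count P (drop k s)));
  case: (position_parity P (take k s)); case: (position_parity P (drop k s)).
Qed.

Lemma position_parity_map (g : nat -> nat) x s : injective g ->
  position_parity (pred1 (g x)) (map g s) = position_parity (pred1 x) s.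
Proof.
move=> gI; elim: s => //= y s ->; rewrite count_map.
by rewrite (eq_count (a2 := pred1 x)) // => z /=; rewrite inj_eq.
Qed.

Section Isomorphism.

Variables (D D' : diagram) (g : nat -> nat) (k : nat).
Hypothesis g_inj : injective g.
Hypothesis codeD' : code D' = rot k (map (rename g) (code D)).

Let namesD' : names D' = rot k (map g (names D)).
Proof. by rewrite /names codeD' map_rot -!map_comp. Qed.

Lemma odd_arrow_iso x : x \in names D -> odd_arrow D' (g x) = odd_arrow D x.
Proof.
move=> xD; apply: odd_arrow_eq => //.
  by rewrite namesD' mem_rot mem_map.
rewrite namesD' position_parity_rot ?position_parity_map //.
  by rewrite size_map even_size_names.
rewrite count_map (eq_count (a2 := pred1 x)) ?odd_count_names // => z /=.
by rewrite inj_eq.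
Qed.

Lemma filter_iso (w : seq endpoint) : {subset w <= code D} ->
  even_part D' (map (rename g) w) =
  map (rename g) (even_part D w).
Proof.
move=> wD; rewrite filter_map; congr map; apply: eq_in_filter => e /wD eD /=.
by rewrite /rename /name /= odd_arrow_iso //; last exact: (map_f name eD).
Qed.

Lemma parity_map_iso : exists k',
  code (parity_map D') = rot k' (map (rename g) (code (parity_map D))).
Proof.
exists (size (map (rename g) (even_part D (take k (code D))))).
rewrite /= codeD' /rot -map_drop -map_take filter_cat.
have tD : {subset take k (code D) <= code D} by move=> e /mem_take.
have dD : {subset drop k (code D) <= code D} by move=> e /mem_drop.
rewrite (filter_iso tD) (filter_iso dD).
rewrite -[X in drop _ (map _ (filter _ X))](cat_take_drop k (code D)).
rewrite -[X in take _ (map _ (filter _ X))](cat_take_drop k (code D)).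
by rewrite filter_cat map_cat drop_size_cat // take_size_cat.
Qed.

Lemma odd_writhe_iso : odd_writhe D' = odd_writhe D.
Proof.
have pD' : perm_eq (arrows D') (map g (arrows D)).
  apply: uniq_perm; rewrite ?map_inj_uniq ?undup_uniq // => z.
  rewrite mem_arrows namesD' mem_rot.
  by apply/mapP/mapP => -[x xD ->]; exists x => //; rewrite mem_arrows in xD *.
rewrite /odd_writhe (perm_big _ pD') /= big_map; apply: eq_big_seq => x.
rewrite mem_arrows => xD; apply: odd_sign_eq => [|s].
  exact: odd_arrow_iso.
rewrite codeD' mem_rot (_ : tail_of s (g x) = rename g (tail_of s x)) //.
by rewrite mem_map // => -[[a r] t] [[a' r'] t'] [] /g_inj -> -> ->.
Qed.

End Isomorphism.

Lemma iso_rot b D D' : iso b D D' -> exists2 g : nat -> nat, injective g &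
  exists k, code D' = rot k (map (rename g) (code D)).
Proof.
by case: b => -[g gI E]; exists g => //; exists 0; rewrite rot0.
Qed.

Lemma odd_writhe_move b D D' :
  iso b D D' \/ reidemeister D D' -> odd_writhe D = odd_writhe D'.
Proof.
case=> [/iso_rot [g gI [k E]]|]; first by rewrite (odd_writhe_iso gI E).
case=> [u v x s o E E' | u v w x y s o s1 s2 P E E'
       | u0 u1 u2 u3 x y z sg oT oM oB s1 s2 s3 P E E'].
- by rewrite (odd_writhe_loop E E').
- by rewrite (odd_writhe_bigon P E E').
- by rewrite (odd_writhe_triangle P E E').
Qed.

Lemma parity_map_move b D D' : iso b D D' \/ reidemeister D D' ->
  (iso b (parity_map D) (parity_map D') \/
   reidemeister (parity_map D) (parity_map D')) \/
  parity_map D = parity_map D'.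
Proof.
case=> [I|].
  left; left; case: b I => -[g gI]; first last.
    by case=> k E; exists g => //; apply: parity_map_iso E.
  move=> E; exists g => //=; rewrite E (@filter_iso D D' g 0) //.
  by rewrite rot0.
case=> [u v x s o E E' | u v w x y s o s1 s2 P E E'
       | u0 u1 u2 u3 x y z sg oT oM oB s1 s2 s3 P E E'].
- by left; right; apply: parity_map_loop E E'.
- by have [] := parity_map_bigon P E E'; [left; right|right].
- have [[w0 [w1 [w2 [w3 [F F']]]]]|] := parity_map_triangle P E E'.
    by left; right; apply: Reidemeister3 P F F'.
  by right.
Qed.

Lemma odd_writhe_iter_invariant b i D D' : same_knot b D D' ->
  odd_writhe (iter i parity_map D) = odd_writhe (iter i parity_map D').
Proof.
elim=> {D D'} [D D' M|//|D D' _ -> //|D1 D2 D3 _ -> _ -> //].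
elim: i D D' M => [|i IHi] D D' M; first exact: odd_writhe_move M.
by rewrite !iterSr; case: (parity_map_move M) => [/IHi|->].
Qed.

(** * Labels and theta *)

Lemma arrow_sign_delete (D : diagram) (p : pred nat) x : ~~ p x ->
  arrow_sign (delete D p) x = arrow_sign D x.
Proof.
by move=> px; apply: arrow_sign_eq => s; rewrite mem_filter [p _](negbTE px).
Qed.

Lemma mem_arrows_delete (D : diagram) (p : pred nat) x :
  (x \in arrows (delete D p)) = ~~ p x && (x \in arrows D).
Proof.
rewrite !mem_arrows /names.
rewrite -[map name (code (delete D p))](filter_map name (predC p)).
by rewrite mem_filter.
Qed.

Lemma arrows_iterS i D x : (x \in arrows (iter i.+1 parity_map D)) =
  ~~ odd_arrow (iter i parity_map D) x && (x \in arrows (iter i parity_map D)).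
Proof. exact: mem_arrows_delete. Qed.

Lemma arrow_sign_iter i D x : x \in arrows (iter i parity_map D) ->
  arrow_sign (iter i parity_map D) x = arrow_sign D x.
Proof.
elim: i => // i IHi; rewrite arrows_iterS => /andP [xe /IHi <-].
exact: arrow_sign_delete.
Qed.

Lemma arrows_iter_sub i j D : i <= j ->
  {subset arrows (iter j parity_map D) <= arrows (iter i parity_map D)}.
Proof.
move=> /subnK <-; elim: (j - i) => // d IHd x.
by rewrite addSn arrows_iterS => /andP [_ /IHd].
Qed.

(** Once deleted, an arrow does not come back, so the first [m] tests of
    [flabel] fail exactly when the arrow is present after [m] deletions. *)
Lemma flabel_eq m D x : x \in arrows D -> (flabel m.+1 D x == m.+1) =
  (x \in arrows (iter m parity_map D)) && odd_arrow (iter m parity_map D) x.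
Proof.
move=> xD; rewrite /flabel eqSS.
rewrite (_ : iota 1 m.+1 = iota 1 m ++ [:: m.+1]); last first.
  by rewrite -[X in iota 1 X]addn1 iotaD add1n.
rewrite find_cat size_iota.
case: ifPn => [hs|/hasPn hn].
  rewrite ltn_eqF; last by rewrite -[X in _ < X](size_iota 1 m) -has_find.
  case/hasP: hs => i; rewrite mem_iota add1n ltnS => /andP [_ im] xi.
  by rewrite (contraNF (arrows_iter_sub im (x := x)) xi).
have xm : x \in arrows (iter m parity_map D).
  case: m hn => // m hn; apply: contraTT (hn m.+1 _) => [->//|].
  by rewrite mem_iota add1n ltnS leqnn.
rewrite /= [_ \in arrows (parity_map _)](arrows_iterS m) xm andbT negbK.
by case: odd_arrow; rewrite ?addn0 ?eqxx // addn1 gtn_eqF.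
Qed.

Lemma thetaE m D : theta m.+1 (Lambda m.+1 D) =
  (\sum_(x <- arrows D | flabel m.+1 D x == m.+1) arrow_sign D x)%R.
Proof.
rewrite /theta /=; elim: (arrows D) => [|x s IHs]; first by rewrite big_nil.
rewrite big_cons /= !PoszD opprD addrACA IHs.
by case: eqP => _; rewrite /arrow_sign ?andbT ?andbF ?subr0 ?add0r.
Qed.

Lemma theta_odd_writhe m D :
  theta m.+1 (Lambda m.+1 D) = odd_writhe (iter m parity_map D).
Proof.
set E := iter m parity_map D.
have -> : odd_writhe E =
    (\sum_(x <- arrows E | odd_arrow E x) arrow_sign D x)%R.
  rewrite /odd_writhe [RHS]big_mkcond; apply: eq_big_seq => x xE.
  by rewrite /odd_sign arrow_sign_iter.
rewrite thetaE -big_filter -[RHS]big_filter; apply: perm_big.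
apply: uniq_perm; rewrite ?filter_uniq ?undup_uniq // => x; rewrite !mem_filter.
have [xD|xD] := boolP (x \in arrows D).
  by rewrite flabel_eq // andbT andbC.
rewrite andbF [x \in _](contraNF (arrows_iter_sub (leq0n m) (x := x)) xD).
by rewrite andbF.
Qed.

(** * Alternating sums of powers *)

Section AlternatingSums.

Local Open Scope ring_scope.

Lemma sum_subsetD1 (V : zmodType) (T : finType) (S : {set T}) s
    (F : {set T} -> V) : s \in S ->
  \sum_(A : {set T} | A \subset S) F A =
  \sum_(A : {set T} | A \subset S :\ s) (F A + F (s |: A)).
Proof.
move=> sS; rewrite big_split /= (bigID (fun A : {set T} => s \in A)) /= addrC.
congr (_ + _); first by apply: eq_bigl => A; rewrite subsetD1.
rewrite (reindex_onto (fun A => s |: A) (fun A => A :\ s)) /=; last first.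
  by move=> A /andP [_ sA]; rewrite setD1K.
apply: eq_bigl => A; rewrite setU11 andbT subsetD1 subUset sub1set sS /=.
have [sA|sA] := boolP (s \in A); last by rewrite setU1K ?eqxx.
by rewrite andbF; apply/negbTE; rewrite negb_and; apply/orP; right;
  apply: contraTneq sA => <-; rewrite setD11.
Qed.

(** Pairing [A] with [s |: A] replaces the power by a finite difference, which
    has lower degree; iterating over the elements of [S] kills all the powers
    below [#|S|] and leaves the multilinear coefficient of the power [#|S|]. *)
Lemma alternating_sum_power (R : comNzRingType) (T : finType) (b : T -> R) n :
  forall (S : {set T}) (c : R), (n <= #|S|)%N ->
  \sum_(A : {set T} | A \subset S) (-1) ^+ #|A| * (c + \sum_(x in A) b x) ^+ n =
  if n == #|S| then (-1) ^+ n * n`!%:R * \prod_(x in S) b x else 0.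
Proof.
move=> S; move Ek: #|S| => k; elim: k S Ek n => [|k IHk] S Sk n c.
  rewrite leqn0 => /eqP ->.
  have -> : S = set0 by apply/eqP; rewrite -cards_eq0 Sk.
  rewrite (big_pred1 set0); last by move=> A; rewrite subset0.
  by rewrite cards0 big_set0 !expr0 !mulr1 ?mul1r.
move=> nk; have [s sS] : exists s, s \in S.
  by apply/set0Pn; rewrite -cards_eq0 Sk.
have S'k : #|S :\ s| = k by move: Sk; rewrite (cardsD1 s) sS => -[].
rewrite (sum_subsetD1 _ sS).
have step (A : {set T}) : A \subset S :\ s ->
  (-1) ^+ #|A| * (c + \sum_(x in A) b x) ^+ n +
  (-1) ^+ #|s |: A| * (c + \sum_(x in s |: A) b x) ^+ n =
  - \sum_(j < n) (b s ^+ (n - j) *+ 'C(n, j)) *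
      ((-1) ^+ #|A| * (c + \sum_(x in A) b x) ^+ j).
  rewrite subsetD1 => /andP [_ sA]; rewrite cardsU1 sA add1n exprS mulN1r mulNr.
  rewrite big_setU1 //= addrCA [(b s + _) ^+ n]exprDn big_ord_recr /=.
  rewrite subnn expr0 mul1r binn mulr1n.
  rewrite mulrDr opprD addrCA subrr addr0 mulr_sumr; congr (- _).
  by apply: eq_bigr => j _; rewrite mulrnAl mulrnAr mulrCA.
rewrite (eq_bigr _ step) sumrN exchange_big /=.
under eq_bigr => j _ do rewrite -mulr_sumr.
have jk (j : 'I_n) : (j <= k)%N by rewrite -ltnS; apply: leq_trans nk.
under eq_bigr => j _ do rewrite (IHk _ S'k _ _ (jk j)).
case: n nk {step} jk => [|n] nk jk; first by rewrite big_ord0 oppr0.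
rewrite big_ord_recr /= big1 ?add0r => [|j _]; last first.
  by rewrite ltn_eqF ?mulr0 // (leq_trans (ltn_ord j)).
rewrite eqSS; case: eqP => [_|_]; last by rewrite mulr0 oppr0.
rewrite subSn // subnn expr1 binSn (big_setD1 s sS) /= factS natrM exprS.
rewrite -mulr_natl !mulN1r !mulNr; congr (- _); ring.
Qed.

End AlternatingSums.

(** * Crossing changes *)

(** Unlike [crossing_changes], this takes a predicate on names, which still
    makes sense after arrows have been deleted. *)
Definition crossing_change_at (D : diagram) (p : pred nat) : diagram :=
  Diagram (flip_codeP D p).

Lemma name_flip p e : name (flip p e) = name e.
Proof. by rewrite /flip; case: ifP. Qed.

Lemma flipK p : involutive (flip p).
Proof.
move=> [[x r] s]; rewrite /flip /name /=.
by case px: (p x); rewrite /= px ?negbK.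
Qed.

Lemma names_crossing_change D p : names (crossing_change_at D p) = names D.
Proof.
by rewrite /names /= -map_comp; apply: eq_map => e; apply: name_flip.
Qed.

Lemma odd_arrow_names D D' : names D = names D' -> odd_arrow D =1 odd_arrow D'.
Proof.
move=> E x; rewrite /odd_arrow /arrows -!/(names _) E; congr odd.
apply: eq_count => y; rewrite /linked -!(filter_map name (mem [:: x; y])).
by rewrite -!/(names _) E.
Qed.

Lemma parity_map_crossing_change D p :
  parity_map (crossing_change_at D p) = crossing_change_at (parity_map D) p.
Proof.
apply: diagram_inj; rewrite /= filter_map; congr map; apply: eq_filter => e /=.
by rewrite name_flip (odd_arrow_names (names_crossing_change D p)).
Qed.

Lemma arrow_sign_crossing_change D p x :
  arrow_sign (crossing_change_at D p) x = ((-1) ^+ p x * arrow_sign D x)%R.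
Proof.
have E s : (tail_of s x \in code (crossing_change_at D p)) =
           (tail_of (p x (+) s) x \in code D).
  rewrite -[tail_of s x](flipK p) mem_map; last exact: inv_inj (flipK p).
  rewrite /flip /name /=; case: (p x) => //=.
  by apply/idP/idP => /opposite_mem.
rewrite /arrow_sign /positive /negative !E.
by case: (p x); rewrite /= ?expr0 ?mul1r // expr1 mulN1r opprB.
Qed.

Lemma flabel_crossing_change m D p x :
  flabel m (crossing_change_at D p) x = flabel m D x.
Proof.
rewrite /flabel; congr S; apply: eq_find => i; congr negb.
have -> : iter i parity_map (crossing_change_at D p) =
          crossing_change_at (iter i parity_map D) p.
  by elim: i => //= i ->; apply: parity_map_crossing_change.
by rewrite !mem_arrows names_crossing_change.
Qed.

Local Open Scope ring_scope.

Lemma sum_arrows (V : zmodType) D (F : nat -> V) :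
  \sum_(x <- arrows D) F x = \sum_(a : arrow D) F (val a).
Proof.
rewrite -(big_map val xpredT F); apply: perm_big; apply: uniq_perm.
- exact: undup_uniq.
- by rewrite map_inj_uniq ?index_enum_uniq //; apply: val_inj.
- move=> x; apply/idP/mapP => [xD|[a _ ->]]; last exact: valP.
  by exists (SeqSub xD); rewrite ?mem_index_enum.
Qed.

Definition label_weight (m : nat) (D : diagram) (a : arrow D) : rat :=
  if flabel m D (val a) == m then (arrow_sign D (val a))%:~R else 0.

(** Theta is linear in the signs: each arrow in [A] changes it by minus twice
    its contribution. *)
Lemma theta_inv_crossing_changes n m D (A : {set arrow D}) :
  theta_inv n m.+1 (crossing_changes A) =
  (\sum_(a : arrow D) label_weight m.+1 a +
   \sum_(a in A) - label_weight m.+1 a *+ 2) ^+ n.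
Proof.
rewrite /theta_inv /theta_pow rmorphXn /= thetaE; congr (_ ^+ n).
have -> : arrows (crossing_changes A) = arrows D.
  by rewrite /arrows -!/(names _) names_crossing_change.
rewrite big_mkcond rmorph_sum /= sum_arrows.
rewrite [X in _ + X]big_mkcond -big_split /=.
apply: eq_bigr => a _.
rewrite flabel_crossing_change arrow_sign_crossing_change.
rewrite (_ : (val a \in [seq val a0 | a0 in A]) = (a \in A)); last first.
  exact: mem_image val_inj _ _.
rewrite /label_weight; case: eqP => _; case: (a \in A);
  rewrite ?oppr0 ?mul0rn ?addr0 ?expr0 ?mul1r //.
by rewrite expr1 mulN1r rmorphN /= mulr2n; lra.
Qed.

Local Close Scope ring_scope.

(** * Diagrams with prescribed image *)

Lemma fresh_nat (s : seq nat) : exists c, c \notin s.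
Proof.
exists (\sum_(x <- s) x).+1; apply/negP => /(big_rem _ (F := id)) /= E.
by have := leqnn (\sum_(x <- s) x); rewrite {1}E ltnNge leq_addr.
Qed.

(** The new arrow [c] spans a single endpoint [e] of [x]: it is linked with [x]
    and with no other arrow. *)
Lemma attach_pendant D x : x \in names D ->
  exists D' c, [/\ c \notin names D, names D' =i c :: names D,
    [seq e <- code D' | name e != c] = code D, odd_arrow D' c &
    forall z, z \in names D -> odd_arrow D' z = odd_arrow D z (+) (z == x)].
Proof.
case/mapP => e eD ->{x}; have [c cD] := fresh_nat (names D).
case/splitPr Ew : {1}(code D) / eD => [u v].
have c_fresh e' : e' \in code D -> name e' != c.
  by move=> e'D; apply: contraNneq cD => <-; apply: map_f.
pose w := u ++ [:: tail_of true c; e; head_of true c] ++ v.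
have pw : perm_eq w ([:: tail_of true c; head_of true c] ++ code D).
  by apply/permP => P; rewrite Ew !count_cat /=; lia.
have wP : gauss_code w.
  apply/andP; split.
    rewrite (perm_uniq (perm_map fst pw)) /= uniq_endpoints andbT !inE.
    rewrite negb_or xpair_eqE andbF /=.
    by apply/andP; split; apply/negP => /mapP [e' /c_fresh] /eqP + E; apply;
      rewrite /name -E.
  rewrite (perm_all _ pw); apply/allP => e'; rewrite (perm_mem pw) !mem_cat.
  case/orP => [|/opposite_mem ->]; last by rewrite orbT.
  by rewrite !inE => /orP [] /eqP ->; rewrite /= eqxx ?orbT.
exists (Diagram wP), c.
have namesD : names D = map name u ++ name e :: map name v.
  by rewrite /names Ew map_cat.
have namesD' :
    names (Diagram wP) = map name u ++ [:: c; name e; c] ++ map name v.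
  by rewrite /names /= map_cat.
have ec : name e != c by apply: c_fresh; rewrite Ew mem_cat mem_head orbT.
have /and3P [cu _ cv] :
    [&& c \notin map name u, c != name e & c \notin map name v].
  by rewrite -!negb_or -in_cons -mem_cat -namesD.
split=> //.
- move=> z; rewrite namesD namesD' !(mem_cat, inE).
  by case: (z == c); case: (z == name e); rewrite /= ?orbT ?orbF.
- have keep t : {subset t <= code D} -> [seq e' <- t | name e' != c] = t.
    by move=> tD; apply/all_filterP/allP => e' /tD /c_fresh.
  rewrite /= filter_cat /= eqxx ec /= !keep //= => e' e't.
    by rewrite Ew mem_cat inE e't !orbT.
  by rewrite Ew mem_cat e't.
- rewrite odd_arrowE namesD' ?mem_cat ?mem_head ?orbT //.
  rewrite position_parity_cat /= /= eqxx (negbTE ec).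
  rewrite !position_parity0 ?has_pred1 // (count_memPn cv) /=.
  by rewrite andbF.
- move=> z zD; have cz : (c == z) = false by apply: contraNF cD => /eqP ->.
  rewrite !odd_arrowE //; last first.
    move: zD; rewrite namesD namesD' !(mem_cat, inE).
    by move=> /or3P [] ->; rewrite ?orbT.
  rewrite namesD namesD' !position_parity_cat /= cz (eq_sym z).
  rewrite !add0n !addn0 !oddD !oddb.
  by case: (name e == z); case: (position_parity _ (map name u));
    case: (position_parity _ _); case: (odd (count_mem _ _));
    case: (odd (size _)).
Qed.

Lemma attach_pendants D (L : seq nat) : uniq L -> {subset L <= names D} ->
  exists D', [/\ [seq e <- code D' | name e \in names D] = code D,
    (forall z, z \in names D -> odd_arrow D' z = odd_arrow D z (+) (z \in L)) &
    forall z, z \in names D' -> z \notin names D -> odd_arrow D' z].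
Proof.
elim: L => [_ _|x L IHL /= /andP [xL UL] LD].
  exists D; split=> [|z _|z ->] //; last by rewrite addbF.
  by apply/all_filterP/allP => e; apply: map_f.
have [|D1 [F1 P1 N1]] := IHL UL.
  by move=> z zL; apply: LD; rewrite inE zL orbT.
have DD1 : {subset names D <= names D1}.
  move=> z /mapP [e]; rewrite -F1 mem_filter => /andP [_ eD1] ->; exact: map_f.
have xD : x \in names D by apply: LD; rewrite mem_head.
have [D2 [c [cD1 D2E F2 c_odd P2]]] := attach_pendant (DD1 _ xD).
have cD : c \notin names D by apply: contra cD1 => /DD1.
exists D2; split.
- rewrite -F1 -F2 -filter_predI; apply: eq_filter => e /=.
  by case: eqP => [->|_]; rewrite /= ?andbT // andbF (negbTE cD).
- move=> z zD; rewrite P2 ?DD1 // P1 // inE -addbA; congr (_ (+) _).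
  by case: eqP => [->|]; rewrite ?(negbTE xL) ?addbF.
- move=> z; rewrite D2E inE => /predU1P [->|zD1 zD] //.
  rewrite P2 // N1 //; case: eqP => // zx; by rewrite zx xD in zD.
Qed.

(** Hanging a pendant on each odd arrow leaves the pendants as the only odd
    arrows. *)
Lemma parity_map_onto D : exists D', parity_map D' = D.
Proof.
have [||D' [F P N]] := @attach_pendants D [seq x <- arrows D | odd_arrow D x].
- by rewrite filter_uniq // undup_uniq.
- by move=> x; rewrite mem_filter mem_arrows => /andP [].
exists D'; apply: diagram_inj; rewrite -F; apply: eq_in_filter => e eD'.
have [eD|eD] := boolP (name e \in names D); last by rewrite N // map_f.
by rewrite P // mem_filter mem_arrows eD andbT addbb.
Qed.

Lemma iter_parity_map_onto m D : exists D', iter m parity_map D' = D.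
Proof.
elim: m D => [|m IHm] D; first by exists D.
have [D1 <-] := parity_map_onto D; have [D2 <-] := IHm D1.
by exists D2.
Qed.

Lemma arrow_sign_neq0 D x : x \in arrows D -> arrow_sign D x != 0%R.
Proof.
rewrite mem_arrows => /mapP [[[y r] s] eD ->] /=.
rewrite (@arrow_signE _ s); first by case: s {eD}.
by case: r eD => // /opposite_mem.
Qed.

(** * Bundles of mutually linked arrows *)

Lemma bundle_codeP N :
  gauss_code (map (tail_of true) (iota 0 N) ++ map (head_of true) (iota 0 N)).
Proof.
apply/andP; split.
  rewrite map_cat -!map_comp cat_uniq !map_inj_uniq ?iota_uniq /=; last 2 first.
  - by move=> x y [].
  - by move=> x y [].
  by rewrite andbT; apply/hasPn => _ /mapP [x _ ->]; apply/negP => /mapP [].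
apply/allP => e; rewrite !mem_cat => /orP [] /mapP [x xN ->].
  by rewrite [X in _ || X](_ : _ = true) ?orbT //; apply/mapP; exists x.
by rewrite [X in X || _](_ : _ = true) //; apply/mapP; exists x.
Qed.

Definition bundle N : diagram := Diagram (bundle_codeP N).

Lemma names_bundle N : names (bundle N) = iota 0 N ++ iota 0 N.
Proof. by rewrite /names /= map_cat -!map_comp !map_id. Qed.

Lemma mem_bundle N x : (x \in names (bundle N)) = (x < N).
Proof. by rewrite names_bundle mem_cat orbb mem_iota. Qed.

Lemma odd_arrow_bundle N x : ~~ odd N -> x < N -> odd_arrow (bundle N) x.
Proof.
move=> Ne xN; rewrite odd_arrowE ?mem_bundle // names_bundle.
by rewrite position_parity_cat addbb size_iota (negbTE Ne).
Qed.

Lemma arrow_sign_bundle N x : x < N -> arrow_sign (bundle N) x = 1%R.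
Proof.
move=> xN; rewrite (@arrow_signE _ true) // mem_cat map_f //.
by rewrite mem_iota.
Qed.

Lemma odd_writhe_bundle N : ~~ odd N -> odd_writhe (bundle N) = Posz N.
Proof.
move=> Ne.
have pN : perm_eq (arrows (bundle N)) (iota 0 N).
  apply: uniq_perm; rewrite ?undup_uniq ?iota_uniq // => x.
  by rewrite mem_arrows mem_bundle mem_iota.
rewrite /odd_writhe (perm_big _ pN) /=.
rewrite (eq_big_seq (fun=> 1%R)); last first.
  move=> x; rewrite mem_iota /= => xN.
  by rewrite /odd_sign odd_arrow_bundle // arrow_sign_bundle.
by rewrite big_const_seq count_predT size_iota iter_addr_0 natz.
Qed.

(** In a bundle of [2 * n] arrows each one is linked with [2 * n - 1] others, so
    all are odd and nothing is left at the next stage. *)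
Theorem exists_deep_bundle n m : 0 < n -> exists D,
  [/\ forall x, x < n -> x \in arrows D /\ flabel m.+1 D x = m.+1,
      theta m.+1 (Lambda m.+1 D) != 0%R &
      forall k, m < k -> theta k.+1 (Lambda k.+1 D) = 0%R].
Proof.
move=> n_gt0; have Ne : ~~ odd n.*2 by rewrite odd_double.
have [D DE] := iter_parity_map_onto m (bundle n.*2); exists D; split.
- move=> x xn; have xN : x < n.*2 by rewrite -addnn ltn_addr.
  have xB : x \in arrows (iter m parity_map D).
    by rewrite DE mem_arrows mem_bundle.
  have xD : x \in arrows D by apply: (arrows_iter_sub (leq0n m)) xB.
  by split=> //; apply/eqP; rewrite flabel_eq // xB DE odd_arrow_bundle.
- rewrite theta_odd_writhe DE odd_writhe_bundle //.
  by rewrite eqz_nat double_eq0 -lt0n.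
- move=> k mk; rewrite theta_odd_writhe /odd_writhe.
  rewrite big1_seq // => x /= /(arrows_iter_sub mk).
  rewrite arrows_iterS DE mem_arrows mem_bundle => /andP [+ xN].
  by rewrite odd_arrow_bundle.
Qed.

Local Open Scope ring_scope.

(** * Degree and linear independence *)

Lemma theta_vanishes n m : vanishes_above n (theta_inv n m.+1).
Proof.
move=> D S Sn; under eq_bigr => A _ do rewrite theta_inv_crossing_changes.
by rewrite alternating_sum_power ?(ltnW Sn) // ltn_eqF.
Qed.

Lemma theta_invariant b n m : knot_invariant b (theta_inv n m.+1).
Proof.
move=> D D' DD'; rewrite /theta_inv /theta_pow !theta_odd_writhe.
by rewrite (odd_writhe_iter_invariant m DD').
Qed.

Lemma theta_not_vanishes n m :
  (0 < n)%N -> ~ vanishes_above n.-1 (theta_inv n m.+1).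
Proof.
move=> n_gt0 V; have [D [B _ _]] := exists_deep_bundle m n_gt0.
(* The first n arrows of the bundle have label m.+1, so nonzero weight. *)
pose a (i : 'I_n) : arrow D := SeqSub (B i (ltn_ord i)).1.
have a_inj : injective a by move=> i j /(congr1 val) /= /val_inj.
pose S := [set a i | i : 'I_n].
have Sn : #|S| = n by rewrite card_imset // card_ord.
have := V D S; rewrite Sn prednK // => /(_ (leqnn n)).
under eq_bigr => A _ do rewrite theta_inv_crossing_changes.
rewrite alternating_sum_power ?Sn // eqxx => /eqP; apply/negP.
rewrite !mulf_neq0 ?expf_neq0 ?oppr_eq0 ?oner_eq0 //.
  by rewrite pnatr_eq0 -lt0n fact_gt0.
apply/prodf_neq0 => _ /imsetP [i _ ->].
rewrite mulrn_eq0 oppr_eq0 /label_weight /=.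
have [aD /eqP ->] := B i (ltn_ord i).
by rewrite intr_eq0 arrow_sign_neq0.
Qed.

Lemma theta_inv_neq0 n m D :
  theta m.+1 (Lambda m.+1 D) != 0 -> theta_inv n m.+1 D != 0.
Proof. by move=> T; rewrite /theta_inv intr_eq0 expf_neq0. Qed.

Lemma theta_inv_eq0 n m D : (0 < n)%N ->
  theta m.+1 (Lambda m.+1 D) = 0 -> theta_inv n m.+1 D = 0.
Proof.
by move=> n0 T; rewrite /theta_inv /theta_pow T expr0n -leqn0 leqNgt n0.
Qed.

Lemma theta_inv_inj n m m' : (0 < n)%N -> (0 < m)%N -> (0 < m')%N ->
  theta_inv n m = theta_inv n m' -> m = m'.
Proof.
move=> n0; wlog mm' : m m' / (m < m')%N => [W m0 m'0 E|].
  by case: (ltngtP m m') => // lt; [apply: W | apply/esym/W].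
case: m m' mm' => // m [//|m'] mm' _ _ E.
have [D [_ Dm Dk]] := exists_deep_bundle m n0.
by have := theta_inv_neq0 n Dm; rewrite E (theta_inv_eq0 n0 (Dk _ mm')) eqxx.
Qed.

(** The matrix of values on the diagrams of [exists_deep_bundle] is triangular
    with nonzero diagonal; the coefficients are killed by increasing level. *)
Lemma theta_independent n : (0 < n)%N -> rat_independent (theta_set n).
Proof.
move=> n0 N F F_inj F_theta c sum0.
have [l Fl] : exists l : 'I_N -> nat, forall i, F i = theta_inv n (l i).+1.
  apply: (@fin_all_exists _ (fun=> nat)
    (fun i k => F i = theta_inv n k.+1)) => i.
  by have [[|k] // _ ->] := F_theta i; exists k.
move=> i; move El: (l i) => k; elim/ltn_ind: k i El => k IHk i El.
have [D [_ Dk Dgt]] := exists_deep_bundle k n0.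
have := sum0 D; rewrite (bigD1 i) //= big1 => [|j ji].
  rewrite addr0 => /eqP; rewrite mulf_eq0 Fl El.
  by rewrite (negbTE (theta_inv_neq0 n Dk)) orbF => /eqP.
case: (ltngtP (l j) k) => [jk|kj|jk].
- by rewrite (IHk _ jk j erefl) mul0r.
- by rewrite Fl (theta_inv_eq0 n0 (Dgt _ kj)) mulr0.
- by case/eqP: ji; apply: F_inj; rewrite !Fl El jk.
Qed.

(** [N.+1] functions in the span of [N] satisfy a linear relation, given by a
    row vector in the kernel of their matrix of coefficients. *)
Lemma independent_not_finite_dimensional (X : Type) (A B : (X -> rat) -> Prop) :
    (forall v, A v -> B v) -> rat_independent A ->
    (forall N, exists2 F : 'I_N -> X -> rat, injective F & forall i, A (F i)) ->
  ~ finite_dimensional B.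
Proof.
move=> AB indep infinite [N [G span]].
have [F F_inj FA] := infinite N.+1.
have [M ME] : exists M : 'I_N.+1 -> 'I_N -> rat,
    forall i x, F i x = \sum_(j < N) M i j * G j x.
  apply: (@fin_all_exists _ (fun=> 'I_N -> rat)
    (fun i r => forall x, F i x = \sum_(j < N) r j * G j x)) => i.
  exact/span/AB.
pose Q := \matrix_(i < N.+1, j < N) M i j.
have kerQ : kermx Q != 0.
  rewrite -mxrank_eq0 mxrank_ker subn_eq0 -ltnNge.
  by apply: leq_ltn_trans (rank_leq_col Q) _.
case/rowV0Pn: kerQ => u /sub_kermxP uQ; case/eqP.
apply/rowP => i; rewrite mxE; move: i; apply: (indep _ F F_inj FA) => x.
under eq_bigr => i _ do rewrite ME mulr_sumr.
rewrite exchange_big big1 //= => j _.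
have /matrixP /(_ 0 j) := uQ; rewrite !mxE => E.
transitivity ((\sum_(i < N.+1) u 0 i * Q i j) * G j x); last by rewrite E mul0r.
by rewrite mulr_suml; apply: eq_bigr => i _; rewrite mxE mulrA.
Qed.

Theorem theta_degree b n v : (0 < n)%N -> theta_set n v ->
  kauffman_degree_exactly b n v.
Proof.
move=> n0 [[|m] // _ ->]; split; last by case=> _; apply: theta_not_vanishes.
by split; [apply: theta_invariant | apply: theta_vanishes].
Qed.

Local Close Scope ring_scope.

Theorem theorem14 (b : base) (n : nat) (hn : 0 < n) :
  [/\ (forall v, theta_set n v -> kauffman_degree_exactly b n v),
      rat_independent (theta_set n),
      (forall m m', 0 < m -> 0 < m' -> theta_inv n m = theta_inv n m' -> m = m')
    & ~ finite_dimensional (kauffman_degree_exactly b n)].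
Proof.
split.
- by move=> v; apply: theta_degree.
- exact: theta_independent.
- by move=> m m'; apply: theta_inv_inj.
apply: independent_not_finite_dimensional (theta_independent hn) _.
  by move=> v; apply: theta_degree.
move=> N; exists (fun i : 'I_N => theta_inv n i.+1) => [i j E|i]; last first.
  by exists i.+1.
by apply: val_inj; have [] := theta_inv_inj hn (ltn0Sn _) (ltn0Sn _) E.
Qed.
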